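(* Let $\alpha_1,\alpha_2>0$ satisfy $\alpha_1-\alpha_2\ge e\sinh 1$. Let $p$ be analytic in $\mathbb{D}$ with $p(0)=1$. If $$1+\alpha_1 zp'(z)+\alpha_2 z^2p''(z)\prec 1+\sin z,$$ then $p(z)\prec e^z$.
   Context: $\mathbb{D}$ is the open unit disk. For $g,h$ analytic in $\mathbb{D}$, $g\prec h$ means there is an analytic $w:\mathbb{D}\to\mathbb{D}$ with $w(0)=0$ and $g=h\circ w$. *)

(* Defs.v *)
From Stdlib Require Import Reals.
From Coquelicot Require Import Coquelicot.
Open Scope R_scope.

Definition in_disk (z : C) : Prop := Cmod z < 1.

Definition holo_disk (f : C -> C) : Prop :=
  forall z : C, in_disk z -> @ex_derive C_AbsRing C_NormedModule f z.

Definition Cexp (z : C) : C :=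
  (exp (Re z) * cos (Im z), exp (Re z) * sin (Im z)).
Definition Csin (z : C) : C :=
  (sin (Re z) * cosh (Im z), cos (Re z) * sinh (Im z)).

Definition subord (g h : C -> C) : Prop :=
  exists w : C -> C, holo_disk w /\ (forall z, in_disk z -> in_disk (w z)) /\
    w 0%C = 0%C /\ (forall z, in_disk z -> g z = h (w z)).

(* Main.v *)
(** Write [q z = z * p1 z] and [b = a1 - a2].  The hypothesis says that
    [a2 z q' + b q = Csin (w z)] has modulus at most [sinh 1], so integrating this
    linear equation along rays gives [|q| <= sinh 1 / b <= 1/e], i.e.
    [|p1 z| <= 1 / (e |z|)].  The mean value property of [p1] on circles of radius
    close to [1 - |z|] removes the singularity at [0]:
    [|p1 z| <= 1 / (e (1 - 2 |z|))] for [|z| < 1/2].  Integrating the better of the two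
    bounds, which cross at [|z| = 1/3], yields [|p z - 1| <= (3/2) (ln 3) / e < 1 - 1/e].
    Since [|log (1 + u)| <= - ln (1 - |u|)], the principal logarithm [w = log p]
    then maps the disk into itself, and [p = exp w]. *)

Require Import Defs.
From Stdlib Require Import Reals Lra.
From Coquelicot Require Import Coquelicot.
Open Scope R_scope.

(** * Complex derivatives as real differentials in two variables *)

Notation is_Cderive := (@is_derive C_AbsRing C_NormedModule).

Lemma is_Cderive_eps (f : C -> C) (z l : C) :
  is_Cderive f z l <->
  forall eps : posreal, exists delta : posreal, forall y : C,
    Cmod (y - z) < delta -> Cmod (f y - f z - (y - z) * l) <= eps * Cmod (y - z).
Proof.
split.
- intros [_ H] eps.
  destruct (H z (fun P HP => HP) eps) as [d Hd].
  exists d. intros y Hy. exact (Hd y Hy).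
- intros H. split.
  + apply is_linear_scal_l.
  + intros x Hx.
    assert (E : x = z).
    { symmetry. apply (is_filter_lim_locally_unique (V := AbsRing_NormedModule C_AbsRing)). exact Hx. }
    subst x. intros eps. destruct (H eps) as [d Hd].
    exists d. intros y Hy. exact (Hd y Hy).
Qed.

Lemma Cmod_le_2Rmax (x y : R) : Cmod (x, y) <= 2 * Rmax (Rabs x) (Rabs y).
Proof.
apply Rle_trans with (1 := Cmod_2Rmax (x, y)). simpl.
apply Rmult_le_compat_r.
- apply Rle_trans with (2 := Rmax_l _ _). apply Rabs_pos.
- apply Rle_trans with (sqrt (2 * 2)); [apply sqrt_le_1; lra | rewrite sqrt_square; lra].
Qed.

Lemma Im_le_Cmod (z : C) : Rabs (Im z) <= Cmod z.
Proof. apply Rle_trans with (2 := Rmax_Cmod z). apply Rmax_r. Qed.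

(** Multiplication by [l] is the real matrix with rows [(Re l, - Im l)] and [(Im l, Re l)]; these
    are the Cauchy-Riemann equations. *)
Lemma is_Cderive_differentiable (f : C -> C) (z l : C) :
  is_Cderive f z l ->
  differentiable_pt_lim (fun x y => Re (f (x, y))) (Re z) (Im z) (Re l) (- Im l) /\
  differentiable_pt_lim (fun x y => Im (f (x, y))) (Re z) (Im z) (Im l) (Re l).
Proof.
intros H.
assert (K : forall eps : posreal, exists delta : posreal, forall u v : R,
  Rabs (u - Re z) < delta -> Rabs (v - Im z) < delta ->
  Cmod (f (u, v) - f z - ((u, v) - z) * l)%C <= eps * Rmax (Rabs (u - Re z)) (Rabs (v - Im z))).
{ intros eps.
  destruct (proj1 (is_Cderive_eps f z l) H (pos_div_2 eps)) as [d Hd].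
  exists (pos_div_2 d). intros u v Hu Hv. simpl in Hu, Hv.
  assert (B := Cmod_le_2Rmax (u - Re z) (v - Im z)).
  assert (E : ((u, v) - z)%C = (u - Re z, v - Im z)) by (destruct z; reflexivity).
  apply Rle_trans with (eps / 2 * Cmod ((u, v) - z)).
  - apply (Hd (u, v)). rewrite E.
    apply Rle_lt_trans with (1 := B).
    assert (Rmax (Rabs (u - Re z)) (Rabs (v - Im z)) < d / 2) by (apply Rmax_lub_lt; assumption).
    lra.
  - rewrite E. assert (He := cond_pos eps). nra. }
split; intros eps; destruct (K eps) as [d Hd]; exists d; intros u v Hu Hv;
  apply Rle_trans with (2 := Hd u v Hu Hv).
- refine (Rle_trans _ _ _ _ (re_le_Cmod _)). right. f_equal. destruct z, l.
  unfold Re, Im, Cminus, Cplus, Copp, Cmult; simpl. ring.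
- refine (Rle_trans _ _ _ _ (Im_le_Cmod _)). right. f_equal. destruct z, l.
  unfold Re, Im, Cminus, Cplus, Copp, Cmult; simpl. ring.
Qed.

(** The real and imaginary parts of the complex remainder are the two real remainders; each is taken
    with [eps / 2] because [Cmod_le_2Rmax] costs a factor [2]. *)
Lemma differentiable_is_Cderive (f : C -> C) (z l : C) :
  differentiable_pt_lim (fun x y => Re (f (x, y))) (Re z) (Im z) (Re l) (- Im l) ->
  differentiable_pt_lim (fun x y => Im (f (x, y))) (Re z) (Im z) (Im l) (Re l) ->
  is_Cderive f z l.
Proof.
intros H1 H2. apply is_Cderive_eps. intros eps.
destruct (H1 (pos_div_2 eps)) as [d1 Hd1].
destruct (H2 (pos_div_2 eps)) as [d2 Hd2].
exists (mkposreal _ (Rmin_stable_in_posreal d1 d2)). simpl. intros y Hy.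
assert (A1 : Rabs (Re y - Re z) <= Cmod (y - z)) by exact (re_le_Cmod (y - z)%C).
assert (A2 : Rabs (Im y - Im z) <= Cmod (y - z)) by exact (Im_le_Cmod (y - z)%C).
assert (M1 := Rmin_l d1 d2). assert (M2 := Rmin_r d1 d2).
assert (B1 := Hd1 (Re y) (Im y) ltac:(lra) ltac:(lra)).
assert (B2 := Hd2 (Re y) (Im y) ltac:(lra) ltac:(lra)).
assert (M : Rmax (Rabs (Re y - Re z)) (Rabs (Im y - Im z)) <= Cmod (y - z)) by (apply Rmax_lub; assumption).
assert (He := cond_pos eps). simpl in B1, B2.
assert (Q : (f y - f z - (y - z) * l)%C =
  (Re (f (Re y, Im y)) - Re (f (Re z, Im z)) - (Re l * (Re y - Re z) + - Im l * (Im y - Im z)),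
   Im (f (Re y, Im y)) - Im (f (Re z, Im z)) - (Im l * (Re y - Re z) + Re l * (Im y - Im z)))).
{ destruct y as [y1 y2], z as [z1 z2], l as [l1 l2]. apply injective_projections; simpl;
  unfold Re, Im; simpl; ring. }
rewrite Q. apply Rle_trans with (1 := Cmod_le_2Rmax _ _).
assert (forall a b, Rmax a b <= eps / 2 * Cmod (y - z) -> 2 * Rmax a b <= eps * Cmod (y - z)) as HH by (intros; lra).
apply HH. apply Rmax_lub.
- apply Rle_trans with (1 := B1). nra.
- apply Rle_trans with (1 := B2). nra.
Qed.

Lemma is_Cderive_curve (f : C -> C) (x y : R -> R) (t dx dy : R) (l : C) :
  is_Cderive f (x t, y t) l -> is_derive x t dx -> is_derive y t dy ->
  is_derive (fun s => Re (f (x s, y s))) t (Re (l * (dx, dy))) /\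
  is_derive (fun s => Im (f (x s, y s))) t (Im (l * (dx, dy))).
Proof.
intros Hf Hx Hy. destruct (is_Cderive_differentiable _ _ _ Hf) as [H1 H2].
apply is_derive_Reals in Hx. apply is_derive_Reals in Hy.
split; apply is_derive_Reals.
- replace (Re (l * (dx, dy))) with (Re l * dx + - Im l * dy) by (unfold Re, Im; simpl; ring).
  apply (derivable_pt_lim_comp_2d (fun x y => Re (f (x, y))) x y); assumption.
- replace (Im (l * (dx, dy))) with (Im l * dx + Re l * dy) by (unfold Re, Im; simpl; ring).
  apply (derivable_pt_lim_comp_2d (fun x y => Im (f (x, y))) x y); assumption.
Qed.

Lemma is_Cderive_comp (f g : C -> C) (z lf lg : C) :
  is_Cderive f (g z) lf -> is_Cderive g z lg ->
  is_Cderive (fun w => f (g w)) z (lf * lg)%C.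
Proof.
intros Hf Hg.
destruct (is_Cderive_differentiable _ _ _ Hf) as [F1 F2].
destruct (is_Cderive_differentiable _ _ _ Hg) as [G1 G2].
(* The real chain rule once for a generic real function [h] of [f], used below with [Re] and
   [Im]. *)
assert (X : forall h : C -> R, forall a b, 
  differentiable_pt_lim (fun x y => h (f (x, y))) (Re (g z)) (Im (g z)) a b ->
  differentiable_pt_lim (fun x y => h (f (g (x, y)))) (Re z) (Im z)
    (a * Re lg + b * Im lg) (a * - Im lg + b * Re lg)).
{ intros h a b H.
  apply (differentiable_pt_lim_ext (fun x y => h (f (Re (g (x, y)), Im (g (x, y)))))).
  { exists (mkposreal 1 Rlt_0_1). intros u v _ _. destruct (g (u, v)); reflexivity. }
  apply (differentiable_pt_lim_comp (fun x y => h (f (x, y)))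
    (fun x y => Re (g (x, y))) (fun x y => Im (g (x, y)))); try assumption.
  destruct z; exact H. }
apply differentiable_is_Cderive.
- replace (Re (lf * lg)) with (Re lf * Re lg + - Im lf * Im lg) by (unfold Re, Im; simpl; ring).
  replace (- Im (lf * lg)) with (Re lf * - Im lg + - Im lf * Re lg) by (unfold Re, Im; simpl; ring).
  exact (X Re _ _ F1).
- replace (Im (lf * lg)) with (Im lf * Re lg + Re lf * Im lg) by (unfold Re, Im; simpl; ring).
  replace (Re (lf * lg)) with (Im lf * - Im lg + Re lf * Re lg) by (unfold Re, Im; simpl; ring).
  exact (X Im _ _ F2).
Qed.

(** * Modulus estimates along rays and a linear differential inequality *)

Lemma nonincreasing_of_derive (f df : R -> R) (a b : R) :
  a <= b ->
  (forall t, a <= t <= b -> is_derive f t (df t)) ->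
  (forall t, a <= t <= b -> df t <= 0) ->
  f b <= f a.
Proof.
intros Hab Hd Hn.
destruct (MVT_gen f a b df) as (c & Hc & E).
- intros x Hx. rewrite Rmin_left, Rmax_right in Hx by lra. apply Hd; lra.
- intros x Hx. rewrite Rmin_left, Rmax_right in Hx by lra.
  apply continuity_pt_filterlim, @ex_derive_continuous. exists (df x). apply Hd; lra.
- rewrite Rmin_left, Rmax_right in Hc by lra. assert (H := Hn c Hc). nra.
Qed.

(** Turns a bound on a modulus into a bound on [Re (u * _)] with [u] fixed, to which one-variable
    real calculus applies. For nonzero [w], [u] is the conjugate of [w] divided by its modulus. *)
Lemma rotate_to_real (w : C) : exists u : C, Cmod u = 1 /\ Re (u * w) = Cmod w.
Proof.
destruct (Ceq_dec w 0) as [-> | H].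
- exists 1%C. rewrite Cmod_1, Cmod_0. split; [reflexivity | unfold Re; simpl; ring].
- assert (P : 0 < Cmod w) by (apply Cmod_gt_0; exact H).
  assert (E : Re (Cconj w * w) = Cmod w * Cmod w).
  { unfold Cmod. rewrite sqrt_sqrt by nra. unfold Re; simpl; ring. }
  exists (RtoC (/ Cmod w) * Cconj w)%C. split.
  + rewrite Cmod_mult, Cmod_R, Cmod_conj, Rabs_pos_eq.
    * field; lra.
    * apply Rlt_le, Rinv_0_lt_compat, P.
  + replace (Re (RtoC (/ Cmod w) * Cconj w * w)) with (/ Cmod w * Re (Cconj w * w)) by (unfold Re; simpl; ring).
    rewrite E. field; lra.
Qed.

Lemma Re_mult_le (u w : C) : Cmod u = 1 -> Re (u * w) <= Cmod w.
Proof.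
intros Hu. apply Rle_trans with (1 := Rle_abs _).
apply Rle_trans with (1 := re_le_Cmod _). rewrite Cmod_mult, Hu. lra.
Qed.

Lemma is_Cderive_scal (k : C) (f : C -> C) (z l : C) :
  is_Cderive f z l -> is_Cderive (fun w => k * f w)%C z (k * l)%C.
Proof.
intros H. refine (filterdiff_ext_lin _ _ _ (filterdiff_scal_r_fct (U := AbsRing_NormedModule C_AbsRing) k f (fun y => scal y l) Cmult_comm H) _); intros y; change (k * (y * l) = y * (k * l))%C; ring.
Qed.

Lemma is_derive_ray (f : C -> C) (u z l : C) (s : R) :
  is_Cderive f (RtoC s * z)%C l ->
  is_derive (fun t => Re (u * f (RtoC t * z))%C) s (Re (u * (l * z))).
Proof.
intros H.
assert (E : forall t, (RtoC t * z)%C = (t * Re z, t * Im z)).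
{ intros t. apply injective_projections; unfold Re, Im; simpl; ring. }
apply (is_derive_ext (fun t => Re (u * f (t * Re z, t * Im z)%R)%C)).
{ intros t. rewrite E. reflexivity. }
replace (Re (u * (l * z))) with (Re (u * l * (Re z, Im z))) by (unfold Re, Im; simpl; ring).
apply (is_Cderive_curve (fun w => u * f w)%C (fun t => t * Re z) (fun t => t * Im z)).
- apply is_Cderive_scal. rewrite <- E. exact H.
- auto_derive; [exact I | ring].
- auto_derive; [exact I | ring].
Qed.

(** Mean value inequality with majorant [psi]: once the increment is rotated onto the positive axis
    by [u], the function [Re (u * f (t z)) - psi t] is nonincreasing. *)
Lemma Cmod_increment_ray (f f1 : C -> C) (z : C) (psi dpsi : R -> R) (a b : R) :
  a <= b ->
  (forall t, a <= t <= b -> is_Cderive f (RtoC t * z)%C (f1 (RtoC t * z)%C)) ->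
  (forall t, a <= t <= b -> is_derive psi t (dpsi t)) ->
  (forall t, a <= t <= b -> Cmod (f1 (RtoC t * z)%C) * Cmod z <= dpsi t) ->
  Cmod (f (RtoC b * z) - f (RtoC a * z))%C <= psi b - psi a.
Proof.
intros Hab Hf Hpsi Hle.
destruct (rotate_to_real (f (RtoC b * z) - f (RtoC a * z))%C) as (u & Hu & E).
rewrite <- E.
assert (H : Re (u * f (RtoC b * z)%C) - psi b <= Re (u * f (RtoC a * z)%C) - psi a).
{ apply (nonincreasing_of_derive (fun t => Re (u * f (RtoC t * z)%C) - psi t)
    (fun t => Re (u * (f1 (RtoC t * z)%C * z)) - dpsi t)); [exact Hab | |].
  - intros t Ht. apply (is_derive_minus (fun t => Re (u * f (RtoC t * z)%C)) psi).
    + apply is_derive_ray, Hf, Ht.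
    + apply Hpsi, Ht.
  - intros t Ht. assert (A := Re_mult_le u (f1 (RtoC t * z)%C * z)%C Hu).
    rewrite Cmod_mult in A. assert (B := Hle t Ht). lra. }
replace (Re (u * (f (RtoC b * z) - f (RtoC a * z))%C)) with
  (Re (u * f (RtoC b * z)%C) - Re (u * f (RtoC a * z)%C)) by (unfold Re; simpl; ring).
lra.
Qed.

(** With the integrating factor [t ^ (b / a)], the product [t ^ (b / a) * (y t - S / b)] is
    nonincreasing, and it is negative near [0], so it stays negative up to [t = 1]. *)
Lemma euler_ode_bound (y dy : R -> R) (a b S : R) :
  0 < a -> 0 < b -> 0 < S -> y 0 = 0 ->
  (forall t, 0 <= t <= 1 -> is_derive y t (dy t)) ->
  (forall t, 0 < t <= 1 -> a * t * dy t + b * y t <= S) ->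
  y 1 <= S / b.
Proof.
intros Ha Hb HS Hy0 Hd Hle.
assert (HSb : 0 < S / b) by (apply Rdiv_lt_0_compat; assumption).
(* The factor [Rpower t (b / a)] goes through [ln t], so the argument starts at some [t0 > 0];
   continuity at [0] keeps [y t0] below [S / b]. *)
assert (Hc : exists t0, 0 < t0 <= 1 /\ y t0 < S / b).
{ assert (C0 : continuous y 0) by (apply @ex_derive_continuous; exists (dy 0); apply Hd; lra).
  destruct (C0 (fun v => v < S / b)) as [d Hdl].
  { rewrite Hy0. apply (open_lt (S / b)). exact HSb. }
  assert (Hdp := cond_pos d).
  exists (Rmin (d / 2) 1). assert (M1 := Rmin_l (d / 2) 1). assert (M2 := Rmin_r (d / 2) 1).
  assert (M3 : 0 < Rmin (d / 2) 1) by (apply Rmin_glb_lt; lra).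
  split; [lra |]. apply Hdl. change (Rabs (Rmin (d / 2) 1 - 0) < d).
  rewrite Rminus_0_r, Rabs_pos_eq; lra. }
destruct Hc as (t0 & Ht0 & Hlt).
assert (H := nonincreasing_of_derive
  (fun t => Rpower t (b / a) * (y t - S / b))
  (fun t => (b / a / t * Rpower t (b / a)) * (y t - S / b) + Rpower t (b / a) * dy t) t0 1 (proj2 Ht0)).
assert (P : forall t, 0 < Rpower t (b / a)) by (intro; apply exp_pos).
cut (Rpower 1 (b / a) * (y 1 - S / b) <= Rpower t0 (b / a) * (y t0 - S / b)).
{ assert (A := P 1). assert (B := P t0). intros K.
  assert (Rpower 1 (b / a) * (y 1 - S / b) < 0) by nra.
  nra. }
apply H; clear H; intros t Ht.
- assert (D := Hd t ltac:(lra)).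
  unfold Rpower. auto_derive.
  + repeat split; [lra | exists (dy t); exact D].
  + replace (Derive (fun x => y x) t) with (dy t) by (symmetry; exact (is_derive_unique _ _ _ D)). field. lra.
- assert (L := Hle t ltac:(lra)). assert (A := P t).
  replace (b / a / t * Rpower t (b / a) * (y t - S / b) + Rpower t (b / a) * dy t)
    with (Rpower t (b / a) * ((a * t * dy t + b * y t - S) * / (a * t))) by (field; lra).
  assert (0 < / (a * t)) by (apply Rinv_0_lt_compat; nra).
  assert ((a * t * dy t + b * y t - S) * / (a * t) <= 0) by nra.
  nra.
Qed.

(** * Bounds for [sinh], the complex sine and [ln 3] *)

(** Convexity of [sinh] on [[0, 1]]: the graph lies above its tangent at [0] and below its chord. *)
Lemma sinh_bounds (y : R) : 0 <= y <= 1 -> y <= sinh y <= y * sinh 1.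
Proof.
intros Hy.
assert (Hm : forall a b, a <= b -> exists c, a <= c <= b /\ sinh b - sinh a = cosh c * (b - a)).
{ intros a b Hab. destruct (MVT_gen sinh a b cosh) as (c & Hc & E).
  - intros x _. apply is_derive_Reals, derivable_pt_lim_sinh.
  - intros x _. apply derivable_continuous_pt, derivable_pt_sinh.
  - rewrite Rmin_left, Rmax_right in Hc by lra. exists c; split; assumption. }
destruct (Hm 0 y) as (c1 & H1 & E1); [lra |].
destruct (Hm y 1) as (c2 & H2 & E2); [lra |].
rewrite sinh_0 in E1.
assert (M : forall s t, 0 <= s <= t -> cosh s <= cosh t).
{ intros s t Hst. assert (- cosh t <= - cosh s); [| lra].
  apply (nonincreasing_of_derive (fun x => - cosh x) (fun x => - sinh x)).
  - lra.
  - intros x _. apply (is_derive_opp cosh). apply is_derive_Reals, derivable_pt_lim_cosh.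
  - intros x Hx. destruct (Req_dec x 0) as [-> | Hx0]; [rewrite sinh_0; lra |].
    assert (sinh 0 < sinh x) by (apply sinh_lt; lra). rewrite sinh_0 in H. lra. }
assert (A := M c1 c2 ltac:(lra)). assert (B := M 0 c1 ltac:(lra)). rewrite cosh_0 in B.
split; [nra |].
(* The mean slope [cosh c1] on [[0, y]] is at most the mean slope [cosh c2] on [[y, 1]]; clearing
   denominators gives the chord bound. *)
assert (cosh c1 * (y * (1 - y)) <= cosh c2 * (y * (1 - y))) by (apply Rmult_le_compat_r; nra).
nra.
Qed.

Lemma Cmod_sqr (z : C) : Cmod z * Cmod z = Re z * Re z + Im z * Im z.
Proof. unfold Cmod. rewrite sqrt_sqrt by nra. unfold Re, Im; ring. Qed.

Lemma sin_sqr_le (x : R) : sin x * sin x <= x * x.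
Proof.
assert (P : forall t, 0 <= t -> sin t * sin t <= t * t).
{ intros t Ht. destruct (Req_dec t 0) as [-> | H0]; [rewrite sin_0; lra |].
  destruct (Rle_dec t 1) as [H1 | H1].
  - assert (sin t < t) by (apply sin_lt_x; lra).
    assert (0 <= sin t) by (apply sin_ge_0; assert (HP := PI2_1); lra). nra.
  - assert (B := SIN_bound t). nra. }
destruct (Rle_dec 0 x) as [H | H]; [exact (P x H) |].
assert (Q := P (- x) ltac:(lra)). rewrite sin_neg in Q. lra.
Qed.

(** From [|sin z|^2 = sin^2 x + sinh^2 y]: the first term is at most [x^2], the second at most
    [sinh^2 1 * y^2], and [sinh 1 >= 1]. *)
Lemma Cmod_Csin_le (z : C) : Cmod z <= 1 -> Cmod (Csin z) <= sinh 1 * Cmod z.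
Proof.
intros Hz.
assert (S1 : 1 <= sinh 1) by (apply sinh_bounds; lra).
assert (Z0 := Cmod_ge_0 z). assert (ZE := Cmod_sqr z).
apply Rsqr_incr_0_var; [| nra]. unfold Rsqr.
rewrite Cmod_sqr. set (x := Re z) in *. set (y := Im z) in *.
change (Re (Csin z)) with (sin x * cosh y). change (Im (Csin z)) with (cos x * sinh y).
replace (sin x * cosh y * (sin x * cosh y) + cos x * sinh y * (cos x * sinh y))
  with (sin x * sin x + sinh y * sinh y).
2: { assert (C := sin2_cos2 x). unfold Rsqr in C.
     assert (H : cosh y * cosh y = 1 + sinh y * sinh y).
     { unfold cosh, sinh. assert (E : exp y * exp (- y) = 1) by (rewrite <- exp_plus, Rplus_opp_r; apply exp_0).
       nra. }
     replace (sin x * cosh y * (sin x * cosh y)) with (sin x * sin x * (cosh y * cosh y)) by ring.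
     rewrite H. nra. }
assert (Hs : sinh y * sinh y <= sinh 1 * sinh 1 * (y * y)).
{ assert (Y1 : y * y <= 1) by nra.
  assert (Q : forall t, 0 <= t <= 1 -> sinh t * sinh t <= sinh 1 * sinh 1 * (t * t)).
  { intros t Ht. destruct (sinh_bounds t Ht) as [L U]. nra. }
  destruct (Rle_dec 0 y) as [Hy | Hy].
  - apply Q. nra.
  - assert (N : sinh (- y) = - sinh y) by (unfold sinh; rewrite Ropp_involutive; field).
    apply Rnot_le_lt in Hy. assert (Y2 : -1 <= y) by (apply Rnot_lt_le; intro; nra).
    assert (K := Q (- y) ltac:(lra)). rewrite N in K. nra. }
assert (Hx := sin_sqr_le x).
assert (S2 : 1 <= sinh 1 * sinh 1) by nra.
assert (x * x <= sinh 1 * sinh 1 * (x * x)) by (assert (0 <= x * x) by nra; nra).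
replace (sinh 1 * Cmod z * (sinh 1 * Cmod z)) with (sinh 1 * sinh 1 * (Cmod z * Cmod z)) by ring.
rewrite ZE, Rmult_plus_distr_l. lra.
Qed.

(** Degree 5 Taylor sums give [e >= 2.7] and [exp (17 / 15) > 3], and [3 / 2 * (17 / 15)] is exactly
    [1.7]. *)
Lemma log3_lt : 3 / 2 * ln 3 < exp 1 - 1.
Proof.
assert (E : 2.7 <= exp 1).
{ refine (Rle_trans _ _ _ _ (exp_ge_taylor 1 5 ltac:(lra))). simpl. lra. }
assert (F : 3 < exp (17 / 15)).
{ refine (Rlt_le_trans _ _ _ _ (exp_ge_taylor (17 / 15) 5 ltac:(lra))). simpl. lra. }
assert (ln 3 < 17 / 15).
{ rewrite <- (ln_exp (17 / 15)). apply ln_increasing; lra. }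
lra.
Qed.

(** * The mean value property on circles, as an inequality *)

Lemma continuity_2d_pt_comp (f g h : R -> R -> R) (x y : R) :
  continuity_2d_pt f (g x y) (h x y) ->
  continuity_2d_pt g x y -> continuity_2d_pt h x y ->
  continuity_2d_pt (fun u v => f (g u v) (h u v)) x y.
Proof.
intros Hf Hg Hh eps. destruct (Hf eps) as [d Hd].
generalize (locally_2d_and _ _ _ _ (Hg d) (Hh d)). apply locally_2d_impl.
apply locally_2d_forall. intros u v [A B]. apply Hd; assumption.
Qed.

Lemma is_derive_mult_plus (a b p q : R -> R) (x da db dp dq : R) :
  is_derive a x da -> is_derive b x db -> is_derive p x dp -> is_derive q x dq ->
  is_derive (fun s => a s * p s + b s * q s) x
    (da * p x + a x * dp + (db * q x + b x * dq)).
Proof.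
intros Ha Hb Hp Hq.
apply (is_derive_plus (fun s => a s * p s) (fun s => b s * q s)).
- exact (is_derive_mult a p x da dp Ha Hp Rmult_comm).
- exact (is_derive_mult b q x db dq Hb Hq Rmult_comm).
Qed.

(* With [F r] the integral of [Re f1] over the circle of radius [r] and [G r] that of
   [Re (f e^(-i th))], one has [G' = F] and, by parts in [th], [G r = r * F r]; hence
   [F] is constant.  Going through the primitive [f] needs no continuity of [f1']. *)
Lemma mean_value_circle_le (f f1 : C -> C) (z0 : C) (r0 R0 M : R) :
  (forall z, Cmod (z - z0) < r0 -> is_Cderive f z (f1 z)) ->
  (forall z, Cmod (z - z0) < r0 ->
     continuity_2d_pt (fun x y => Re (f1 (x, y))) (Re z) (Im z)) ->
  0 < R0 < r0 ->
  (forall z, Cmod (z - z0) = R0 -> Re (f1 z) <= M) ->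
  Re (f1 z0) <= M.
Proof.
intros Hf Hc HR HM.
set (X := fun r th => Re z0 + r * cos th).
set (Y := fun r th => Im z0 + r * sin th).
set (A := fun r th => Re (f1 (X r th, Y r th))).
set (g := fun r th => Re (f (X r th, Y r th)) * cos th + Im (f (X r th, Y r th)) * sin th).
assert (Hmod : forall r th, Cmod ((X r th, Y r th) - z0)%C = Rabs r).
{ intros r th. rewrite <- (sqrt_Rsqr_abs r). unfold Cmod. f_equal.
  unfold X, Y, Re, Im, Rsqr; simpl.
  replace (fst z0 + r * cos th + - fst z0) with (r * cos th) by ring.
  replace (snd z0 + r * sin th + - snd z0) with (r * sin th) by ring.
  assert (T := sin2_cos2 th). unfold Rsqr in T.
  replace (r * cos th * (r * cos th * 1) + r * sin th * (r * sin th * 1))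
    with (r * r * (sin th * sin th + cos th * cos th)) by ring.
  rewrite T. ring. }
assert (Hin : forall r th, Rabs r < r0 -> is_Cderive f (X r th, Y r th) (f1 (X r th, Y r th))).
{ intros r th Hr. apply Hf. rewrite Hmod. exact Hr. }
(* The radial derivative of [f] is [f1 e^(i th)]; the rotation [e^(-i th)] built into [g] cancels
   the phase. *)
assert (Hgr : forall r th, Rabs r < r0 -> is_derive (fun s => g s th) r (A r th)).
{ intros r th Hr.
  destruct (is_Cderive_curve f (fun s => X s th) (fun s => Y s th) r (cos th) (sin th) _ (Hin r th Hr)) as [D1 D2].
  - unfold X; auto_derive; [exact I | ring].
  - unfold Y; auto_derive; [exact I | ring].
  - unfold g.
    evar_last.
    + apply (is_derive_mult_plus _ _ (fun _ => cos th) (fun _ => sin th) _ _ _ 0 0 D1 D2);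
        apply (@is_derive_const R_AbsRing R_NormedModule).
    + unfold A. assert (T := sin2_cos2 th). unfold Rsqr in T.
      set (w := f1 (X r th, Y r th)). unfold Re, Im; simpl.
      replace (fst w) with (fst w * (sin th * sin th + cos th * cos th)) at 3 by (rewrite T; ring).
      ring. }
assert (Hth : forall r th, Rabs r < r0 ->
  is_derive (fun t => Re (f (X r t, Y r t))) th (Re (f1 (X r th, Y r th) * (- r * sin th, r * cos th))) /\
  is_derive (fun t => Im (f (X r t, Y r t))) th (Im (f1 (X r th, Y r th) * (- r * sin th, r * cos th)))).
{ intros r th Hr. apply (is_Cderive_curve f (fun t => X r t) (fun t => Y r t)).
  - exact (Hin r th Hr).
  - unfold X; auto_derive; [exact I | ring].
  - unfold Y; auto_derive; [exact I | ring]. }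
assert (HA2 : forall r th, Rabs r < r0 -> continuity_2d_pt A r th).
{ intros r th Hr. unfold A.
  apply (continuity_2d_pt_comp (fun x y => Re (f1 (x, y))) X Y).
  - apply (Hc (X r th, Y r th)). rewrite Hmod. exact Hr.
  - unfold X. apply continuity_2d_pt_plus; [apply continuity_2d_pt_const |].
    apply continuity_2d_pt_mult; [apply continuity_2d_pt_id1 |].
    apply (continuity_1d_2d_pt_comp cos (fun _ v => v)); [apply continuity_cos | apply continuity_2d_pt_id2].
  - unfold Y. apply continuity_2d_pt_plus; [apply continuity_2d_pt_const |].
    apply continuity_2d_pt_mult; [apply continuity_2d_pt_id1 |].
    apply (continuity_1d_2d_pt_comp sin (fun _ v => v)); [apply continuity_sin | apply continuity_2d_pt_id2]. }
assert (HAc : forall r th, Rabs r < r0 -> continuous (A r) th).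
{ intros r th Hr. apply continuity_pt_filterlim. intros e He.
  destruct (HA2 r th Hr (mkposreal e He)) as [d Hd].
  exists d. split; [apply cond_pos |]. intros t [_ Ht]. apply (Hd r t).
  - rewrite Rminus_diag, Rabs_R0. apply cond_pos.
  - exact Ht. }
assert (Hgc : forall r th, Rabs r < r0 -> continuous (g r) th).
{ intros r th Hr. destruct (Hth r th Hr) as [D1 D2].
  apply (@ex_derive_continuous R_AbsRing R_NormedModule). unfold g.
  apply (ex_derive_plus (fun t => Re (f (X r t, Y r t)) * cos t) (fun t => Im (f (X r t, Y r t)) * sin t)).
  - apply ex_derive_mult; [eexists; exact D1 | auto_derive; exact I].
  - apply ex_derive_mult; [eexists; exact D2 | auto_derive; exact I]. }
assert (HgI : forall r, Rabs r < r0 -> ex_RInt (g r) 0 (2 * PI)).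
{ intros r Hr. apply (@ex_RInt_continuous R_CompleteNormedModule). intros t _. exact (Hgc r t Hr). }
assert (HAI : forall r, Rabs r < r0 -> ex_RInt (A r) 0 (2 * PI)).
{ intros r Hr. apply (@ex_RInt_continuous R_CompleteNormedModule). intros t _. exact (HAc r t Hr). }
set (G := fun r => RInt (g r) 0 (2 * PI) : R).
set (F := fun r => RInt (A r) 0 (2 * PI) : R).
assert (Hloc : forall r, Rabs r < r0 -> locally r (fun s => Rabs s < r0)).
{ intros r Hr. exists (mkposreal (r0 - Rabs r) ltac:(lra)). intro s'. pose (s := s' : R).
  change (ball r (r0 - Rabs r) s -> Rabs s < r0). clearbody s. clear s'. intros Hs.
  change (Rabs (s - r) < r0 - Rabs r) in Hs.
  assert (T := Rabs_triang (s - r) r). replace (s - r + r) with s in T by (simpl; ring). lra. }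
(* Differentiation under the integral sign, where the joint continuity [HA2] enters. *)
assert (HG : forall r, Rabs r < r0 -> is_derive G r (F r)).
{ intros r Hr.
  replace (F r) with (RInt (fun t => Derive (fun u => g u t) r) 0 (2 * PI)).
  2: { unfold F. apply RInt_ext. intros t _. apply is_derive_unique, Hgr, Hr. }
  apply (is_derive_RInt_param g 0 (2 * PI) r).
  - apply (filter_imp (fun s => Rabs s < r0)); [| exact (Hloc r Hr)]. intros s Hs t _. exists (A s t). exact (Hgr s t Hs).
  - intros t _. apply (continuity_2d_pt_ext_loc A); [| exact (HA2 r t Hr)].
    destruct (Hloc r Hr) as [d Hd]. exists d. intros u v Hu _.
    symmetry. apply is_derive_unique, Hgr. apply Hd. exact Hu.
  - apply (filter_imp (fun s => Rabs s < r0)); [| exact (Hloc r Hr)]. exact HgI. }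
(* [Re (i f e^(-i th))] has angular derivative [g r th - r * A r th] and period [2 PI]. *)
assert (HGF : forall r, Rabs r < r0 -> G r = r * F r).
{ intros r Hr.
  set (h := fun th => Re (f (X r th, Y r th)) * sin th + Im (f (X r th, Y r th)) * - cos th).
  assert (I1 : is_RInt (fun th => g r th - r * A r th) 0 (2 * PI) (minus (h (2 * PI)) (h 0))).
  { apply (is_RInt_derive (V := R_CompleteNormedModule)).
    - intros th _. destruct (Hth r th Hr) as [D1 D2]. unfold h.
      evar_last.
      + apply (is_derive_mult_plus _ _ sin (fun t => - cos t) _ _ _ (cos th) (sin th) D1 D2).
        * apply is_derive_sin.
        * auto_derive; [exact I | ring].
      + unfold A, g. assert (T := sin2_cos2 th). unfold Rsqr in T.
        match goal with |- ?a = ?b => change (@eq R a b) end.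
        set (w := f1 (X r th, Y r th)). unfold Re, Im; simpl.
        replace (r * fst w) with (r * fst w * (sin th * sin th + cos th * cos th)) by (rewrite T; ring).
        ring.
    - intros th _. apply (continuous_minus (V := R_NormedModule) (g r) (fun t => r * A r t)).
      + exact (Hgc r th Hr).
      + apply (continuous_scal_r (V := R_NormedModule) r (A r)). exact (HAc r th Hr). }
  assert (I2 : is_RInt (fun th => g r th - r * A r th) 0 (2 * PI) (G r - r * F r)).
  { apply (is_RInt_minus (V := R_NormedModule) (g r) (fun t => r * A r t)).
    - exact (RInt_correct (V := R_CompleteNormedModule) _ _ _ (HgI r Hr)).
    - apply (is_RInt_scal (V := R_NormedModule) (A r)). exact (RInt_correct (V := R_CompleteNormedModule) _ _ _ (HAI r Hr)). }
  assert (E : minus (h (2 * PI)) (h 0) = 0).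
  { unfold h, X, Y. rewrite cos_2PI, sin_2PI, cos_0, sin_0. apply (minus_eq_zero (G := R_AbelianGroup)). }
  rewrite E in I1.
  assert (U1 := is_RInt_unique (V := R_CompleteNormedModule) _ _ _ _ I1).
  assert (U2 := is_RInt_unique (V := R_CompleteNormedModule) _ _ _ _ I2).
  rewrite U1 in U2. lra. }
(* By [HGF] the derivative of [G r / r] vanishes, so [G] is linear on [(0, R0]]. *)
assert (HK : forall e, 0 < e <= R0 -> G e = e * F R0).
{ intros e He.
  destruct (MVT_gen (fun r => G r / r) e R0 (fun r => (F r * r - G r) / (r * r))) as (c & Hcc & E).
  - intros r Hr. rewrite Rmin_left, Rmax_right in Hr by lra.
    assert (D := HG r ltac:(rewrite Rabs_pos_eq; lra)).
    evar_last.
    + apply (is_derive_div G (fun r => r) r (F r) 1); [exact D | apply @is_derive_id | lra].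
    + unfold minus, plus, opp, mult; simpl. field. lra.
  - intros r Hr. rewrite Rmin_left, Rmax_right in Hr by lra.
    assert (D := HG r ltac:(rewrite Rabs_pos_eq; lra)).
    apply continuity_pt_filterlim.
    apply (ex_derive_continuous (K := R_AbsRing) (V := R_NormedModule) (fun r => G r / r) r).
    eexists. apply (is_derive_div G (fun r => r) r (F r) 1); [exact D | apply @is_derive_id | lra].
  - rewrite Rmin_left, Rmax_right in Hcc by lra.
    rewrite (HGF c) in E by (rewrite Rabs_pos_eq; lra).
    rewrite (HGF R0) in E by (rewrite Rabs_pos_eq; lra).
    replace ((F c * c - c * F c) / (c * c)) with 0 in E by (field; lra).
    replace (R0 * F R0 / R0) with (F R0) in E by (field; lra).
    replace (F R0) with (G e / e) by lra. field. lra. }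
(* The difference quotient of [G] at [0] tends to [F 0], yet equals [F R0] for every small step [e].
   Taking the distance of the two values as the tolerance gives the contradiction. *)
assert (E0 : F 0 = F R0).
{ assert (R00 : Rabs 0 < r0) by (rewrite Rabs_R0; lra).
  assert (D := HG 0 R00). apply is_derive_Reals in D.
  destruct (Req_dec (F 0) (F R0)) as [H | H]; [exact H | exfalso].
  assert (P : 0 < Rabs (F R0 - F 0)) by (apply Rabs_pos_lt; lra).
  destruct (D _ P) as [d Hd]. assert (Hdp := cond_pos d).
  set (e := Rmin (d / 2) R0).
  assert (M1 := Rmin_l (d / 2) R0 : e <= _). assert (M2 := Rmin_r (d / 2) R0 : e <= _).
  assert (M3 : 0 < e) by (apply Rmin_glb_lt; lra).
  assert (Q := Hd e ltac:(lra) ltac:(rewrite Rabs_pos_eq; lra)).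
  rewrite Rplus_0_l, (HK e), (HGF 0 R00) in Q by lra.
  replace ((e * F R0 - 0 * F 0) / e) with (F R0) in Q by (field; lra). lra. }
assert (PP := PI_RGT_0).
assert (V0 : F 0 = 2 * PI * Re (f1 z0)).
{ unfold F. rewrite (RInt_ext (A 0) (fun _ => Re (f1 z0))).
  - rewrite RInt_const. unfold scal; simpl. unfold mult; simpl. ring.
  - intros t _. unfold A, X, Y. rewrite !Rmult_0_l, !Rplus_0_r. destruct z0; reflexivity. }
assert (VR : F R0 <= 2 * PI * M).
{ unfold F. replace (2 * PI * M) with (RInt (fun _ => M) 0 (2 * PI)).
  - apply RInt_le; [lra | apply HAI; rewrite Rabs_pos_eq; lra | apply ex_RInt_const |].
    intros t _. apply HM. rewrite Hmod. apply Rabs_pos_eq. lra.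
  - rewrite RInt_const. unfold scal; simpl. unfold mult; simpl. ring. }
rewrite <- E0, V0 in VR. apply Rmult_le_reg_l with (2 * PI); lra.
Qed.

(** * The principal logarithm on the right half-plane *)

(** The formula [atan (Im z / Re z)] is the principal argument for [0 < Re z], the only region where
    it is used. *)
Definition Clog (z : C) : C :=
  (ln (Re z * Re z + Im z * Im z) / 2, atan (Im z / Re z)).

Lemma Cexp_Clog (z : C) : 0 < Re z -> Cexp (Clog z) = z.
Proof.
destruct z as [x y]. unfold Clog, Cexp, Re, Im; simpl. intros Hx.
assert (N : 0 < x * x + y * y) by nra.
rewrite cos_atan, sin_atan.
assert (S : sqrt (x * x + y * y) = x * sqrt (1 + Rsqr (y / x))).
{ replace (x * x + y * y) with (x * x * (1 + Rsqr (y / x))) by (unfold Rsqr; field; lra).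
  rewrite sqrt_mult, sqrt_square; [reflexivity | lra | nra | assert (T := Rle_0_sqr (y / x)); lra]. }
assert (P : 0 < sqrt (1 + Rsqr (y / x))) by (apply sqrt_lt_R0; assert (T := Rle_0_sqr (y / x)); lra).
replace (exp (ln (x * x + y * y) / 2)) with (sqrt (x * x + y * y)).
2: { rewrite <- (exp_ln (sqrt (x * x + y * y))) by (apply sqrt_lt_R0, N).
  f_equal. rewrite <- (sqrt_sqrt (x * x + y * y)) at 2 by lra.
  rewrite ln_mult by (apply sqrt_lt_R0, N). field. }
rewrite S. apply injective_projections; simpl; field; lra.
Qed.

Lemma differentiable_of_partials (f fx : R -> R -> R) (x y ly : R) :
  locally_2d (fun u v => is_derive (fun t => f t v) u (fx u v)) x y ->
  is_derive (fun t => f x t) y ly ->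
  continuity_2d_pt fx x y ->
  differentiable_pt_lim f x y (fx x y) ly.
Proof.
intros H1 H2 H3. apply filterdiff_differentiable_pt_lim.
apply (is_derive_filterdiff f x y fx ly).
- apply locally_2d_locally in H1. exact H1.
- exact H2.
- apply continuity_2d_pt_filterlim. exact H3.
Qed.

(** The partial derivatives of [ln |z|] and of the argument are, up to sign, [x / |z|^2] and
    [y / |z|^2], the components of [1 / z]; they are continuous off [0]. *)
Lemma is_Cderive_Clog (z : C) : 0 < Re z -> is_Cderive Clog z (/ z)%C.
Proof.
destruct z as [x y]. unfold Re at 1; simpl. intros Hx.
assert (Hn : forall a b, 0 < a -> 0 < a * a + b * b) by (intros; nra).
assert (Hpos : locally_2d (fun u _ => 0 < u) x y).
{ exists (mkposreal x Hx). intros u v Hu _. simpl in Hu. apply Rabs_def2 in Hu. lra. }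
assert (Cn : continuity_2d_pt (fun u v => u * u + v * v) x y).
{ apply continuity_2d_pt_plus; apply continuity_2d_pt_mult;
  (apply continuity_2d_pt_id1 || apply continuity_2d_pt_id2). }
assert (N := Hn x y Hx).
apply differentiable_is_Cderive.
- replace (Re (/ (x, y))%C) with (x * / (x * x + y * y)) by (unfold Re; simpl; field; lra).
  replace (- Im (/ (x, y))%C) with (y / (x * x + y * y)) by (unfold Im; simpl; field; lra).
  apply (differentiable_of_partials (fun u v => ln (u * u + v * v) / 2) (fun u v => u * / (u * u + v * v))).
  + revert Hpos. apply locally_2d_impl, locally_2d_forall. intros u v Hu. simpl.
    assert (M := Hn u v Hu). auto_derive; [lra | field; lra].
  + simpl. auto_derive; [lra | field; lra].
  + apply continuity_2d_pt_mult; [apply continuity_2d_pt_id1 |].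
    apply continuity_2d_pt_inv; [exact Cn | simpl; lra].
- replace (Im (/ (x, y))%C) with ((- y) * / (x * x + y * y)) by (unfold Im; simpl; field; lra).
  replace (Re (/ (x, y))%C) with (x / (x * x + y * y)) by (unfold Re; simpl; field; lra).
  apply (differentiable_of_partials (fun u v => atan (v / u)) (fun u v => (- v) * / (u * u + v * v))).
  + revert Hpos. apply locally_2d_impl, locally_2d_forall. intros u v Hu. simpl.
    assert (M := Hn u v Hu). auto_derive; [lra | unfold Rsqr; field; split; [lra | nra]].
  + simpl. auto_derive; [lra | unfold Rsqr; field; split; [nra | lra]].
  + apply continuity_2d_pt_mult; [apply continuity_2d_pt_opp, continuity_2d_pt_id2 |].
    apply continuity_2d_pt_inv; [exact Cn | simpl; lra].
Qed.

(** Integrate [u / (1 + t u)] over [[0, 1]]: its modulus is at most [|u| / (1 - t |u|)], with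
    primitive [- ln (1 - t |u|)]. *)
Lemma Cmod_Clog_le (u : C) : Cmod u < 1 -> Cmod (Clog (1 + u)) <= - ln (1 - Cmod u).
Proof.
intros Hu. assert (U0 := Cmod_ge_0 u).
assert (HD : forall w, is_Cderive (fun w => RtoC 1 + w)%C w (RtoC 1)).
{ intros w. apply is_Cderive_eps. intros eps. exists (mkposreal 1 Rlt_0_1). intros y _.
  replace (1 + y - (1 + w) - (y - w) * 1)%C with (RtoC 0) by ring. rewrite Cmod_0.
  assert (A := cond_pos eps). assert (B := Cmod_ge_0 (y - w)%C). nra. }
(* Used twice: it keeps [1 + t u] in the half-plane where [Clog] is differentiable, and it bounds
   [|1 + t u|] from below. *)
assert (Hre : forall t, 0 <= t <= 1 -> 1 - t * Cmod u <= Re (1 + RtoC t * u)%C).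
{ intros t Ht. assert (B := re_le_Cmod u). apply Rabs_le_between in B.
  replace (Re (1 + RtoC t * u)%C) with (1 + t * Re u) by (unfold Re; simpl; ring). nra. }
assert (H := Cmod_increment_ray (fun w : C => Clog (1 + w)%C) (fun w : C => / (1 + w))%C u
  (fun t => - ln (1 - t * Cmod u)) (fun t => Cmod u / (1 - t * Cmod u)) 0 1 Rle_0_1).
cbv beta in H.
replace (RtoC 1 * u)%C with u in H by ring.
replace (1 + RtoC 0 * u)%C with (RtoC 1) in H by ring.
replace (Clog 1) with (RtoC 0) in H.
2: { unfold Clog, Re, Im; simpl. replace (1 * 1 + 0 * 0) with 1 by ring.
  replace (0 / 1) with 0 by field. rewrite ln_1, atan_0. unfold RtoC. f_equal. field. }
replace (Clog (1 + u) - 0)%C with (Clog (1 + u)) in H by ring.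
replace (- ln (1 - 0 * Cmod u)) with 0 in H by (rewrite Rmult_0_l, Rminus_0_r, ln_1; ring).
rewrite Rmult_1_l, Rminus_0_r in H. apply H; clear H; intros t Ht.
- assert (A := Hre t Ht).
  replace (/ (1 + RtoC t * u))%C with (/ (1 + RtoC t * u) * 1)%C by ring.
  apply (is_Cderive_comp Clog (fun w => RtoC 1 + w)%C); [| apply HD].
  apply is_Cderive_Clog. nra.
- auto_derive; [nra | field; nra].
- assert (A := Hre t Ht). assert (B : 0 < 1 - t * Cmod u) by nra.
  assert (Q := Rle_trans _ _ _ A (Rle_trans _ _ _ (Rle_abs _) (re_le_Cmod _))).
  rewrite Cmod_inv. 
  + unfold Rdiv. rewrite Rmult_comm. apply Rmult_le_compat_l; [exact U0 |].
    apply Rinv_le_contravar; assumption.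
  + intros E. rewrite E, Cmod_0 in Q. lra.
Qed.

(** * Bounds for the derivative [p1] and for the increment of [p] *)

(** Along the ray, [y t = Re (u t z p1 (t z))] satisfies [a2 t y' + (a1 - a2) y = Re (u * (a1 v p1 +
    a2 v^2 p2))] at [v = t z]: differentiating the factor [t] produces one [a2 y], hence the
    coefficient [a1 - a2]. *)
Lemma euler_operator_bound (a1 a2 S : R) (p1 p2 : C -> C) :
  0 < a2 -> 0 < a1 - a2 -> 0 < S ->
  (forall z, in_disk z -> is_Cderive p1 z (p2 z)) ->
  (forall z, in_disk z ->
     Cmod (RtoC a1 * z * p1 z + RtoC a2 * (z * z) * p2 z)%C <= S) ->
  forall z, in_disk z -> Cmod z * Cmod (p1 z) <= S / (a1 - a2).
Proof.
unfold in_disk. intros Ha2 Hb HS Hp1 Hle z Hz.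
assert (Hin : forall t, 0 <= t <= 1 -> Cmod (RtoC t * z)%C < 1).
{ intros t Ht. rewrite Cmod_mult, Cmod_R, Rabs_pos_eq by lra. assert (A := Cmod_ge_0 z). nra. }
destruct (rotate_to_real (z * p1 z)%C) as (u & Hu & E).
rewrite <- Cmod_mult, <- E.
assert (H := euler_ode_bound (fun t => t * Re (u * z * p1 (RtoC t * z))%C)
  (fun t => Re (u * z * p1 (RtoC t * z))%C + t * Re (u * z * (p2 (RtoC t * z) * z))%C)
  a2 (a1 - a2) S Ha2 Hb HS).
cbv beta in H. replace (RtoC 1 * z)%C with z in H by ring.
replace (u * (z * p1 z))%C with (u * z * p1 z)%C by ring.
rewrite Rmult_1_l in H. apply H; clear H.
- ring.
- intros t Ht.
  assert (D := is_derive_ray p1 (u * z)%C z _ t (Hp1 _ (Hin t Ht))).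
  evar_last.
  + exact (is_derive_mult (fun t => t) _ t _ _ (@is_derive_id R_AbsRing t) D Rmult_comm).
  + unfold plus, mult, one; simpl. ring.
- intros t Ht. set (v := (RtoC t * z)%C).
  assert (Q := Rle_trans _ _ _ (Re_mult_le u _ Hu) (Hle v (Hin t ltac:(lra)))).
  apply Rle_trans with (2 := Q). right. unfold v, Re; simpl. ring.
Qed.

(** Points on the circle of radius [|z| + d] about [z] have modulus at least [d], so [|p1| <= c / d]
    there, and the mean value carries this to [z]. The circle lies in the disk as long as
    [d < 1 - 2 |z|]. *)
Lemma Cmod_derivative_bound_half (p p1 p2 : C -> C) (c : R) (z : C) :
  0 < c ->
  (forall z, in_disk z -> is_Cderive p z (p1 z)) ->
  (forall z, in_disk z -> is_Cderive p1 z (p2 z)) ->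
  (forall z, in_disk z -> Cmod z * Cmod (p1 z) <= c) ->
  Cmod z < 1 / 2 -> Cmod (p1 z) * (1 - 2 * Cmod z) <= c.
Proof.
unfold in_disk. intros Hc Hp Hp1 Hle Hz. assert (Z0 := Cmod_ge_0 z).
destruct (Rle_dec (Cmod (p1 z) * (1 - 2 * Cmod z)) c) as [H | H]; [exact H | exfalso].
apply Rnot_le_lt in H.
destruct (rotate_to_real (p1 z)) as (u & Hu & E).
set (k := Cmod (p1 z)) in *.
assert (Hk : 0 < k) by nra.
(* If the bound failed, [c / k < 1 - 2 |z|]; the midpoint [d] is then admissible and
   [k <= c / d < k] is absurd. *)
set (d := (c / k + (1 - 2 * Cmod z)) / 2).
assert (Hd0 : 0 < c / k) by (apply Rdiv_lt_0_compat; assumption).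
assert (Hd1 : c / k < 1 - 2 * Cmod z).
{ apply Rmult_lt_reg_l with k; [exact Hk |]. replace (k * (c / k)) with c by (field; lra). exact H. }
assert (Hd : c / k < d < 1 - 2 * Cmod z) by (unfold d; lra).
assert (Hball : forall w, Cmod (w - z) < 1 - Cmod z -> Cmod w < 1).
{ intros w Hw. assert (T := Cmod_triangle (w - z) z).
  replace (w - z + z)%C with w in T by ring. lra. }
assert (M : Re (u * p1 z) <= c / d).
{ apply (mean_value_circle_le (fun w => u * p w)%C (fun w => u * p1 w)%C z
    (1 - Cmod z) (Cmod z + d)).
  - intros w Hw. apply is_Cderive_scal, Hp, Hball, Hw.
  - intros w Hw. apply differentiable_continuity_pt.
    destruct (is_Cderive_differentiable _ _ _ (is_Cderive_scal u _ _ _ (Hp1 w (Hball w Hw)))) as [D _].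
    eexists. eexists. exact D.
  - lra.
  - intros w Hw. apply Rle_trans with (1 := Re_mult_le u _ Hu).
    assert (L := Hle w (Hball w ltac:(lra))).
    assert (T := Cmod_triangle (w - z) z).
    assert (T2 := Cmod_triangle w (- z)). rewrite Cmod_opp in T2.
    change (w + - z)%C with (w - z)%C in T2.
    assert (K := Cmod_ge_0 (p1 w)).
    apply Rmult_le_reg_l with d; [lra |].
    replace (d * (c / d)) with c by (field; lra). nra. }
rewrite E in M.
assert (k * d <= c).
{ replace c with (c / d * d) by (field; lra). apply Rmult_le_compat_r; lra. }
assert (k * (c / k) < k * d) by (apply Rmult_lt_compat_l; lra).
replace (k * (c / k)) with c in H1 by (field; lra). lra.
Qed.

(** Up to radius [1 / 3], integrating [c / (1 - 2 s)] gives at most [c / 2 * ln 3]; from there to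
    [|z| < 1], integrating [c / s] gives at most [c * ln 3]. *)
Lemma Cmod_increment_bound (p p1 p2 : C -> C) (c : R) (z : C) :
  0 < c ->
  (forall z, in_disk z -> is_Cderive p z (p1 z)) ->
  (forall z, in_disk z -> is_Cderive p1 z (p2 z)) ->
  (forall z, in_disk z -> Cmod z * Cmod (p1 z) <= c) ->
  in_disk z -> Cmod (p z - p 0)%C <= c * (3 / 2 * ln 3).
Proof.
unfold in_disk. intros Hc Hp Hp1 Hle Hz. assert (Z0 := Cmod_ge_0 z).
assert (L3 : 0 < ln 3) by (rewrite <- ln_1; apply ln_increasing; lra).
set (m := Cmod z) in *.
assert (Hmod : forall t, 0 <= t -> Cmod (RtoC t * z)%C = t * m).
{ intros t Ht. rewrite Cmod_mult, Cmod_R, Rabs_pos_eq by lra. reflexivity. }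
assert (Hin : forall t, 0 <= t <= 1 -> Cmod (RtoC t * z)%C < 1).
{ intros t Ht. rewrite Hmod by lra. nra. }
assert (Inner : forall b, 0 <= b <= 1 -> b * m <= 1 / 3 -> Cmod (p (RtoC b * z) - p 0)%C <= c * (1 / 2 * ln 3)).
{ intros b Hb Hbm.
  assert (Ht : forall t, 0 <= t <= b -> 0 <= t * m <= 1 / 3) by (intros t Ht; nra).
  assert (H := Cmod_increment_ray p p1 z (fun t => - (c / 2) * ln (1 - 2 * (t * m)))
    (fun t => c * m / (1 - 2 * (t * m))) 0 b (proj1 Hb)).
  cbv beta in H. replace (RtoC 0 * z)%C with (RtoC 0) in H by ring.
  apply Rle_trans with (- (c / 2) * ln (1 - 2 * (b * m)) - - (c / 2) * ln (1 - 2 * (0 * m))).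
  - apply H; clear H; intros t Htb; assert (B := Ht t Htb).
    + apply Hp, Hin. lra.
    + auto_derive; [lra | field; lra].
    + assert (K := Cmod_derivative_bound_half p p1 p2 c (RtoC t * z)%C Hc Hp Hp1 Hle).
      rewrite Hmod in K by lra. specialize (K ltac:(lra)).
      fold m. apply Rmult_le_reg_r with (1 - 2 * (t * m)); [lra |].
      replace (c * m / (1 - 2 * (t * m)) * (1 - 2 * (t * m))) with (c * m) by (field; lra).
      nra.
  - rewrite Rmult_0_l, Rmult_0_r, Rminus_0_r, ln_1.
    assert (- ln 3 <= ln (1 - 2 * (b * m))).
    { rewrite <- ln_Rinv by lra. assert (B := Ht b ltac:(lra)). apply ln_le; lra. }
    nra. }
destruct (Rle_dec m (1 / 3)) as [Hm | Hm].
- assert (H := Inner 1 ltac:(lra) ltac:(lra)). replace (RtoC 1 * z)%C with z in H by ring. nra.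
(* [a] is the parameter at which the ray [t z] crosses the circle of radius [1 / 3]. *)
- apply Rnot_le_lt in Hm. set (a := / (3 * m)).
  assert (Ha0 : 0 < a) by (apply Rinv_0_lt_compat; lra).
  assert (Ham : a * m = 1 / 3) by (unfold a; field; lra).
  assert (Ha1 : a <= 1) by nra.
  assert (H0 := Inner a ltac:(lra) ltac:(lra)).
  assert (H1 := Cmod_increment_ray p p1 z (fun t => c * ln t) (fun t => c / t) a 1 Ha1).
  cbv beta in H1. replace (RtoC 1 * z)%C with z in H1 by ring.
  assert (H2 : Cmod (p z - p (RtoC a * z))%C <= c * ln 1 - c * ln a).
  { apply H1; clear H1; intros t Ht.
    - apply Hp, Hin. lra.
    - auto_derive; [lra | field; lra].
    - assert (K := Hle (RtoC t * z)%C (Hin t ltac:(lra))). rewrite Hmod in K by lra.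
      fold m. apply Rmult_le_reg_l with t; [lra |].
      replace (t * (c / t)) with c by (field; lra). lra. }
  assert (La : - ln a <= ln 3).
  { unfold a. rewrite ln_Rinv by lra. rewrite Ropp_involutive. apply ln_le; lra. }
  assert (T := Cmod_triangle (p z - p (RtoC a * z)%C) (p (RtoC a * z)%C - p 0)).
  replace (p z - p (RtoC a * z) + (p (RtoC a * z) - p 0))%C with (p z - p 0)%C in T by ring.
  rewrite ln_1 in H2. nra.
Qed.

(** * Subordination to the exponential *)

(** The radius [1 - 1 / e] is where [- ln (1 - |u|)] reaches [1]. Being below [1], it also keeps [p]
    in the right half-plane, so [Clog (p z)] is the required Schwarz function. *)
Lemma subord_Cexp_of_near_1 (p p1 : C -> C) :
  (forall z, in_disk z -> is_Cderive p z (p1 z)) -> p 0%C = 1%C ->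
  (forall z, in_disk z -> Cmod (p z - 1)%C < 1 - / exp 1) ->
  subord p Cexp.
Proof.
intros Hp H0 Hnear.
assert (E1 := Rinv_0_lt_compat _ (exp_pos 1)).
assert (Hre : forall z, in_disk z -> 0 < Re (p z)).
{ intros z Hz. assert (A := Hnear z Hz).
  assert (B := re_le_Cmod (p z - 1)%C). apply Rabs_le_between in B.
  replace (Re (p z - 1)%C) with (Re (p z) - 1) in B by (unfold Re; simpl; ring). lra. }
exists (fun z => Clog (p z)). repeat split.
- intros z Hz. exists (/ p z * p1 z)%C.
  apply (is_Cderive_comp Clog p); [apply is_Cderive_Clog, Hre, Hz | exact (Hp z Hz)].
- intros z Hz. assert (A := Hnear z Hz). unfold in_disk.
  assert (B := Cmod_Clog_le (p z - 1)%C ltac:(lra)).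
  replace (1 + (p z - 1))%C with (p z) in B by ring.
  apply Rle_lt_trans with (1 := B).
  assert (- 1 < ln (1 - Cmod (p z - 1))); [| lra].
  replace (- 1) with (ln (/ exp 1)) by (rewrite ln_Rinv, ln_exp; [lra | apply exp_pos]).
  apply ln_increasing; lra.
- rewrite H0. unfold Clog, Re, Im; simpl.
  replace (1 * 1 + 0 * 0) with 1 by ring.
  replace (0 / 1) with 0 by field. rewrite ln_1, atan_0. unfold RtoC. f_equal. field.
- intros z Hz. symmetry. apply Cexp_Clog, Hre, Hz.
Qed.

Theorem theorem4p7 (a1 a2 : R) (p p1 p2 : C -> C) :
  0 < a1 -> 0 < a2 -> a1 - a2 >= exp 1 * sinh 1 ->
  (forall z, in_disk z -> @is_derive C_AbsRing C_NormedModule p z (p1 z)) ->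
  (forall z, in_disk z -> @is_derive C_AbsRing C_NormedModule p1 z (p2 z)) ->
  p 0%C = 1%C ->
  subord (fun z => (1 + RtoC a1 * z * p1 z + RtoC a2 * (z * z) * p2 z)%C)
         (fun z => (1 + Csin z)%C) ->
  subord p Cexp.
Proof.
intros _ Ha2 Hb Hp Hp1 Hp0 (w & _ & Hw & _ & Heq).
assert (E1 := exp_pos 1).
assert (S1 : 1 <= sinh 1) by (apply sinh_bounds; lra).
assert (Hb0 : 0 < a1 - a2) by nra.
(* Here [e * sinh 1 <= a1 - a2] turns the bound [sinh 1 / (a1 - a2)] into [1 / e]. *)
assert (Hq : forall z, in_disk z -> Cmod z * Cmod (p1 z) <= / exp 1).
{ intros z Hz.
  apply Rle_trans with (sinh 1 / (a1 - a2)).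
  - apply (euler_operator_bound a1 a2 (sinh 1) p1 p2); try assumption; [lra |].
    intros v Hv.
    replace (RtoC a1 * v * p1 v + RtoC a2 * (v * v) * p2 v)%C with (Csin (w v)).
    + assert (A := Hw v Hv). unfold in_disk in A.
      apply Rle_trans with (1 := Cmod_Csin_le _ (Rlt_le _ _ A)). nra.
    + replace (Csin (w v)) with (1 + Csin (w v) - 1)%C by ring.
      rewrite <- (Heq v Hv). ring.
  - apply Rmult_le_reg_r with (a1 - a2); [lra |].
    replace (sinh 1 / (a1 - a2) * (a1 - a2)) with (sinh 1) by (field; lra).
    apply Rmult_le_reg_l with (exp 1); [lra |].
    replace (exp 1 * (/ exp 1 * (a1 - a2))) with (a1 - a2) by (field; lra). lra. }
apply (subord_Cexp_of_near_1 p p1 Hp Hp0).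
intros z Hz. rewrite <- Hp0.
assert (Hinv : 0 < / exp 1) by (apply Rinv_0_lt_compat, E1).
apply Rle_lt_trans with (1 := Cmod_increment_bound p p1 p2 _ z Hinv Hp Hp1 Hq Hz).
(* Factoring out [1 / e] reduces the final comparison to [3 / 2 * ln 3 < e - 1]. *)
replace (1 - / exp 1) with (/ exp 1 * (exp 1 - 1)) by (field; lra).
apply Rmult_lt_compat_l; [exact Hinv | exact log3_lt].
Qed.
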